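(* Consider the internal $2$-cube in $\mathrm{CAT}$ given by the categories and functors $$(1,\infty)\text{-}\mathbb{C}\mathbb{T}\mathrm{rans}\ \xrightarrow{\ \sigma^2_{1,1},\,\sigma^2_{1,2},\,\tau^2_{1,1},\,\tau^2_{1,2}\ }\ \infty\text{-}\mathbb{C}\mathbb{F}\mathrm{unct}\ \xrightarrow{\ \sigma^1_0,\,\tau^1_0\ }\ \infty\text{-}\mathbb{C}\mathbb{C}\mathrm{AT},$$ where for an object $\tau$ with top functor $F$, right functor $G$, left functor $H$ and bottom functor $K$ one has $\sigma^2_{1,1}(\tau)=F$, $\tau^2_{1,1}(\tau)=K$, $\sigma^2_{1,2}(\tau)=H$, $\tau^2_{1,2}(\tau)=G$, and $\sigma^1_0,\tau^1_0$ send a strict cubical $\infty$-functor to its domain and codomain (with the evident action on morphisms). This internal $2$-cube of $\mathrm{CAT}$ can be structured in a strict cubical $2$-category: there exist reflexions, connections and compositions, all given by functors, making it a strict cubical $2$-category internal to $\mathrm{CAT}$.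
   Context: $\mathrm{CAT}$ is the category of (possibly large) categories and functors. **Cubical sets.** A cubical set is a family of sets $(C_n)_{n\ge 0}$ with maps (sources and targets) $s^n_{n-1,j},t^n_{n-1,j}:C_n\to C_{n-1}$ for $n\ge1$, $1\le j\le n$, such that for $1\le i<j\le n$: $s^{n-1}_{n-2,i}s^n_{n-1,j}=s^{n-1}_{n-2,j-1}s^n_{n-1,i}$; $s^{n-1}_{n-2,i}t^n_{n-1,j}=t^{n-1}_{n-2,j-1}s^n_{n-1,i}$; $t^{n-1}_{n-2,i}s^n_{n-1,j}=s^{n-1}_{n-2,j-1}t^n_{n-1,i}$; $t^{n-1}_{n-2,i}t^n_{n-1,j}=t^{n-1}_{n-2,j-1}t^n_{n-1,i}$. **Reflexive cubical sets.** A reflexive cubical set is a cubical set with maps $1^{n}_{n+1,j}:C_n\to C_{n+1}$ ($n\ge0$, $1\le j\le n+1$; classical reflexions) and $1^{n,\gamma}_{n+1,j}:C_n\to C_{n+1}$ ($n\ge1$, $1\le j\le n$, $\gamma\in\{+,-\}$; connections) such that, whenever the maps are defined (and with $r$ denoting either $s$ everywhere or $t$ everywhere): - $1^n_{n+1,i}1^{n-1}_{n,j}=1^n_{n+1,j+1}1^{n-1}_{n,i}$ for $1\le i\le j\le n$; - $r^n_{n-1,i}1^{n-1}_{n,j}=1^{n-2}_{n-1,j-1}r^{n-1}_{n-2,i}$ for $1\le i<j\le n$; $=1^{n-2}_{n-1,j}r^{n-1}_{n-2,i-1}$ for $1\le j<i\le n$; $=\mathrm{id}$ for $i=j$; - $1^{n,\gamma}_{n+1,i}1^{n-1,\gamma}_{n,j}=1^{n,\gamma}_{n+1,j+1}1^{n-1,\gamma}_{n,i}$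 for $1\le i<j\le n-1$, and $1^{n,\gamma}_{n+1,i}1^{n-1,\gamma}_{n,i}=1^{n,\gamma}_{n+1,i+1}1^{n-1,\gamma}_{n,i}$ for $1\le i\le n-1$; - $1^{n,\gamma}_{n+1,i}1^{n-1}_{n,j}=1^n_{n+1,j+1}1^{n-1,\gamma}_{n,i}$ for $1\le i<j\le n$; $=1^n_{n+1,j}1^{n-1,\gamma}_{n,i-1}$ for $1\le j<i\le n$; and $1^{n,\gamma}_{n+1,j}1^{n-1}_{n,j}=1^n_{n+1,j}1^{n-1}_{n,j}$ for $1\le j\le n$; - $r^n_{n-1,i}1^{n-1,\gamma}_{n,j}=1^{n-2,\gamma}_{n-1,j-1}r^{n-1}_{n-2,i}$ for $1\le i<j\le n-1$; $=1^{n-2,\gamma}_{n-1,j}r^{n-1}_{n-2,i-1}$ for $2\le j+1<i\le n$; - for $1\le j\le n-1$: $s^n_{n-1,j}1^{n-1,-}_{n,j}=s^n_{n-1,j+1}1^{n-1,-}_{n,j}=\mathrm{id}$, $t^n_{n-1,j}1^{n-1,+}_{n,j}=t^n_{n-1,j+1}1^{n-1,+}_{n,j}=\mathrm{id}$, $s^n_{n-1,j}1^{n-1,+}_{n,j}=s^n_{n-1,j+1}1^{n-1,+}_{n,j}=1^{n-2}_{n-1,j}s^{n-1}_{n-2,j}$, $t^n_{n-1,j}1^{n-1,-}_{n,j}=t^n_{n-1,j+1}1^{n-1,-}_{n,j}=1^{n-2}_{n-1,j}t^{n-1}_{n-2,j}$. **Cubical reflexive $\infty$-magmas.** A reflexive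 cubical set with partial operations $\circ^n_j$ on $C_n$ ($n\ge1$, $1\le j\le n$), where $a\circ^n_jb$ is defined exactly when $t^n_{n-1,j}(a)=s^n_{n-1,j}(b)$, such that $s^n_{n-1,j}(a\circ^n_jb)=s^n_{n-1,j}(a)$, $t^n_{n-1,j}(a\circ^n_jb)=t^n_{n-1,j}(b)$, and for $r\in\{s,t\}$: $r^n_{n-1,i}(a\circ^n_jb)=r^n_{n-1,i}(a)\circ^{n-1}_{j-1}r^n_{n-1,i}(b)$ if $i<j$, and $=r^n_{n-1,i}(a)\circ^{n-1}_{j}r^n_{n-1,i}(b)$ if $j<i$. Morphisms are maps commuting with sources, targets, reflexions, connections and the operations $\circ^n_j$. **Strict cubical $\infty$-categories.** A strict cubical $\infty$-category is a cubical reflexive $\infty$-magma such that the operations are associative and unital ($1^{n-1}_{n,j}(s^n_{n-1,j}(a))\circ^n_ja=a=a\circ^n_j1^{n-1}_{n,j}(t^n_{n-1,j}(a))$), and such that: - interchange: $(a\circ^n_ib)\circ^n_j(c\circ^n_id)=(a\circ^n_jc)\circ^n_i(b\circ^n_jd)$ for $i\ne j$ whenever both sides are defined; - $1^n_{n+1,i}(a\circ^n_jb)=1^n_{n+1,i}(a)\circ^{n+1}_{j+1}1^n_{n+1,i}(b)$ if $1\le i\le j\le n$, and $=1^n_{n+1,i}(a)\circ^{n+1}_j1^n_{n+1,i}(b)$ if $1\le j<i\le n+1$; - $1^{n,\gamma}_{n+1,i}(a\circ^n_jb)=1^{n,\gamma}_{n+1,i}(a)\circ^{n+1}_{j+1}1^{n,\gamma}_{n+1,i}(b)$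 if $1\le i<j\le n$, and $=1^{n,\gamma}_{n+1,i}(a)\circ^{n+1}_j1^{n,\gamma}_{n+1,i}(b)$ if $1\le j<i\le n$; - transport laws, for $1\le j\le n$: $1^{n,+}_{n+1,j}(a\circ^n_jb)=\bigl(1^{n,+}_{n+1,j}(a)\circ^{n+1}_j1^n_{n+1,j}(a)\bigr)\circ^{n+1}_{j+1}\bigl(1^n_{n+1,j+1}(a)\circ^{n+1}_j1^{n,+}_{n+1,j}(b)\bigr)$ and $1^{n,-}_{n+1,j}(a\circ^n_jb)=\bigl(1^{n,-}_{n+1,j}(a)\circ^{n+1}_j1^n_{n+1,j+1}(b)\bigr)\circ^{n+1}_{j+1}\bigl(1^n_{n+1,j}(b)\circ^{n+1}_j1^{n,-}_{n+1,j}(b)\bigr)$; - for $1\le i\le n$: $1^{n,+}_{n+1,i}(x)\circ^{n+1}_i1^{n,-}_{n+1,i}(x)=1^n_{n+1,i+1}(x)$ and $1^{n,+}_{n+1,i}(x)\circ^{n+1}_{i+1}1^{n,-}_{n+1,i}(x)=1^n_{n+1,i}(x)$. $\infty\text{-}\mathbb{C}\mathbb{C}\mathrm{AT}$ is the category of strict cubical $\infty$-categories with, as morphisms (strict cubical $\infty$-functors), the morphisms of cubical reflexive $\infty$-magmas. **$\infty\text{-}\mathbb{C}\mathbb{F}\mathrm{unct}$.** Objects are strict cubical $\infty$-functors $F:C\to D$; a morphism from $F:C\to D$ to $F':C'\to D'$ is a pair $(c:C\to C',d:D\to D')$ of strict cubical $\infty$-functors with $dF=F'c$. **$(1,\infty)\text{-}\mathbb{C}\mathbb{T}\mathrm{rans}$.**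 An object $\tau$ (cubical strict $\infty$-natural transformation) consists of strict cubical $\infty$-categories $C_{0,0},C_{1,0},C_{0,1},C_{1,1}$, strict cubical $\infty$-functors $F:C_{0,0}\to C_{1,0}$ (top), $G:C_{1,0}\to C_{1,1}$ (right), $H:C_{0,0}\to C_{0,1}$ (left), $K:C_{0,1}\to C_{1,1}$ (bottom), and for each $0$-cell $a$ of $C_{0,0}$ a $1$-cell $\tau(a):G(F(a))\to K(H(a))$ of $C_{1,1}$ such that $G(F(f))\circ^1_1\tau(b)=\tau(a)\circ^1_1K(H(f))$ for every $1$-cell $f:a\to b$ of $C_{0,0}$. A morphism $\tau\to\tau'$ is a quadruple of strict cubical $\infty$-functors $c_{i,j}:C_{i,j}\to C'_{i,j}$ with $c_{1,0}F=F'c_{0,0}$, $c_{1,1}G=G'c_{1,0}$, $c_{0,1}H=H'c_{0,0}$, $c_{1,1}K=K'c_{0,1}$, and $c_{1,1}(\tau(a))=\tau'(c_{0,0}(a))$ for all $0$-cells $a$. **Strict cubical $2$-category internal to $\mathrm{CAT}$.** This is the truncation to dimensions $0,1,2$ of the definition of strict cubical $\infty$-category above, with sets and maps replaced by categories and functors: categories $C_0,C_1,C_2$, functors $s^1_{0,1},t^1_{0,1}:C_1\to C_0$, $s^2_{1,j},t^2_{1,j}:C_2\to C_1$ ($j=1,2$), $1^0_{1,1}:C_0\to C_1$, $1^1_{2,1},1^1_{2,2},1^{1,-}_{2,1},1^{1,+}_{2,1}:C_1\to C_2$, and composition functors $\circ^1_1,\circ^2_1,\circ^2_2$ defined on the pullbacks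 of $t_j$ along $s_j$, satisfying all those axioms above (cubical relations, reflexion and connection relations, axioms on sources and targets of composites, associativity, units, interchange, compatibility of reflexions and connections with compositions, transport laws and the last pair of laws) that involve only this data. Here $C_0=\infty\text{-}\mathbb{C}\mathbb{C}\mathrm{AT}$, $C_1=\infty\text{-}\mathbb{C}\mathbb{F}\mathrm{unct}$, $C_2=(1,\infty)\text{-}\mathbb{C}\mathbb{T}\mathrm{rans}$, $s^1_{0,1}=\sigma^1_0$, $t^1_{0,1}=\tau^1_0$, $s^2_{1,j}=\sigma^2_{1,j}$, $t^2_{1,j}=\tau^2_{1,j}$. *)

(* Defs.v *)
From mathcomp Require Import all_boot.
From mathcomp Require Import boolp.

Set Implicit Arguments.
Unset Strict Implicit.
Unset Printing Implicit Defensive.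

(* Directions are 1-based natural numbers carrying a (boolean, hence          *)
(* irrelevant) proof that they lie in the range where the operation exists;   *)
(* no cell or operation is added outside that range.  In every law below the  *)
(* range proofs and the composability proofs are universally quantified: this *)
(* reads "whenever all the terms are defined".  Composability proofs whose    *)
(* type is omitted are inferred from the composite in which they are used.    *)

Variant side := Src | Tgt.
Variant sign := Minus | Plus.

(* [face Src h : C n.+1 -> C n], with [h : 1 <= j <= n.+1], is s^{n+1}_{n,j}; *)
(* [face Tgt h] is t^{n+1}_{n,j}.                                             *)
Record CubicalSet := {
  cell :> nat -> Type;
  face : side -> forall n j, 1 <= j <= n.+1 -> cell n.+1 -> cell n;
  face_face : forall (d e : side) n i j
      (hi : 1 <= i <= n.+1) (hj : 1 <= j <= n.+2)
      (hi' : 1 <= i <= n.+2) (hj' : 1 <= j.-1 <= n.+1) (x : cell n.+2),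
    i < j -> face d hi (face e hj x) = face e hj' (face d hi' x) }.

Arguments face {_} _ {n j} _ _.

(* [deg h], with [h : 1 <= j <= n.+1], is 1^n_{n+1,j}; [conn g h], with       *)
(* [h : 1 <= j <= n], is 1^{n,g}_{n+1,j}.                                     *)
Record ReflexiveCubicalSet := {
  rcs_cubicalSet :> CubicalSet;
  deg : forall n j, 1 <= j <= n.+1 ->
    rcs_cubicalSet n -> rcs_cubicalSet n.+1;
  conn : sign -> forall n j, 1 <= j <= n ->
    rcs_cubicalSet n -> rcs_cubicalSet n.+1;
  deg_deg : forall n i j
      (hi : 1 <= i <= n.+2) (hj : 1 <= j <= n.+1)
      (hj' : 1 <= j.+1 <= n.+2) (hi' : 1 <= i <= n.+1) (x : rcs_cubicalSet n),
    i <= j -> deg hi (deg hj x) = deg hj' (deg hi' x);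
  face_deg_lt : forall (d : side) n i j
      (hi : 1 <= i <= n.+2) (hj : 1 <= j <= n.+2)
      (hj' : 1 <= j.-1 <= n.+1) (hi' : 1 <= i <= n.+1) (x : rcs_cubicalSet n.+1),
    i < j -> face d hi (deg hj x) = deg hj' (face d hi' x);
  face_deg_gt : forall (d : side) n i j
      (hi : 1 <= i <= n.+2) (hj : 1 <= j <= n.+2)
      (hj' : 1 <= j <= n.+1) (hi' : 1 <= i.-1 <= n.+1) (x : rcs_cubicalSet n.+1),
    j < i -> face d hi (deg hj x) = deg hj' (face d hi' x);
  face_deg_eq : forall (d : side) n j (hj : 1 <= j <= n.+1) (x : rcs_cubicalSet n),
    face d hj (deg hj x) = x;
  conn_conn_lt : forall (g : sign) n i j
      (hi : 1 <= i <= n.+1) (hj : 1 <= j <= n)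
      (hj' : 1 <= j.+1 <= n.+1) (hi' : 1 <= i <= n) (x : rcs_cubicalSet n),
    i < j -> conn g hi (conn g hj x) = conn g hj' (conn g hi' x);
  conn_conn_eq : forall (g : sign) n i
      (hi : 1 <= i <= n.+1) (hi' : 1 <= i <= n)
      (hi1 : 1 <= i.+1 <= n.+1) (x : rcs_cubicalSet n),
    conn g hi (conn g hi' x) = conn g hi1 (conn g hi' x);
  conn_deg_lt : forall (g : sign) n i j
      (hi : 1 <= i <= n.+1) (hj : 1 <= j <= n.+1)
      (hj' : 1 <= j.+1 <= n.+2) (hi' : 1 <= i <= n) (x : rcs_cubicalSet n),
    i < j -> conn g hi (deg hj x) = deg hj' (conn g hi' x);
  conn_deg_gt : forall (g : sign) n i j
      (hi : 1 <= i <= n.+1) (hj : 1 <= j <= n.+1)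
      (hj' : 1 <= j <= n.+2) (hi' : 1 <= i.-1 <= n) (x : rcs_cubicalSet n),
    j < i -> conn g hi (deg hj x) = deg hj' (conn g hi' x);
  conn_deg_eq : forall (g : sign) n j
      (hj : 1 <= j <= n.+1) (hj' : 1 <= j <= n.+2) (x : rcs_cubicalSet n),
    conn g hj (deg hj x) = deg hj' (deg hj x);
  face_conn_lt : forall (d : side) (g : sign) n i j
      (hi : 1 <= i <= n.+2) (hj : 1 <= j <= n.+1)
      (hj' : 1 <= j.-1 <= n) (hi' : 1 <= i <= n.+1) (x : rcs_cubicalSet n.+1),
    i < j -> face d hi (conn g hj x) = conn g hj' (face d hi' x);
  face_conn_gt : forall (d : side) (g : sign) n i j
      (hi : 1 <= i <= n.+2) (hj : 1 <= j <= n.+1)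
      (hj' : 1 <= j <= n) (hi' : 1 <= i.-1 <= n.+1) (x : rcs_cubicalSet n.+1),
    j.+1 < i -> face d hi (conn g hj x) = conn g hj' (face d hi' x);
  src_connM : forall n j (h : 1 <= j <= n.+1)
      (hj : 1 <= j <= n.+2) (hj1 : 1 <= j.+1 <= n.+2) (x : rcs_cubicalSet n.+1),
    face Src hj (conn Minus h x) = x /\ face Src hj1 (conn Minus h x) = x;
  tgt_connP : forall n j (h : 1 <= j <= n.+1)
      (hj : 1 <= j <= n.+2) (hj1 : 1 <= j.+1 <= n.+2) (x : rcs_cubicalSet n.+1),
    face Tgt hj (conn Plus h x) = x /\ face Tgt hj1 (conn Plus h x) = x;
  src_connP : forall n j (h : 1 <= j <= n.+1)
      (hj : 1 <= j <= n.+2) (hj1 : 1 <= j.+1 <= n.+2) (x : rcs_cubicalSet n.+1),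
    face Src hj (conn Plus h x) = deg h (face Src h x) /\
    face Src hj1 (conn Plus h x) = deg h (face Src h x);
  tgt_connM : forall n j (h : 1 <= j <= n.+1)
      (hj : 1 <= j <= n.+2) (hj1 : 1 <= j.+1 <= n.+2) (x : rcs_cubicalSet n.+1),
    face Tgt hj (conn Minus h x) = deg h (face Tgt h x) /\
    face Tgt hj1 (conn Minus h x) = deg h (face Tgt h x) }.

Arguments deg {_ n j} _ _.
Arguments conn {_} _ {n j} _ _.

(* [ccomp h a b e] is the composite of a and b in direction j, a first.       *)
Unset Implicit Arguments.
Record CubicalMagma := {
  mag_reflexive :> ReflexiveCubicalSet;
  ccomp : forall {n j} (h : 1 <= j <= n.+1) (a b : mag_reflexive n.+1),
    face Tgt h a = face Src h b -> mag_reflexive n.+1;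
  src_ccomp : forall n j (h : 1 <= j <= n.+1) (a b : mag_reflexive n.+1) e,
    face Src h (ccomp h a b e) = face Src h a;
  tgt_ccomp : forall n j (h : 1 <= j <= n.+1) (a b : mag_reflexive n.+1) e,
    face Tgt h (ccomp h a b e) = face Tgt h b;
  face_ccomp_lt : forall (d : side) n i j
      (hi : 1 <= i <= n.+2) (hj : 1 <= j <= n.+2) (hj' : 1 <= j.-1 <= n.+1)
      (a b : mag_reflexive n.+2) e e',
    i < j ->
    face d hi (ccomp hj a b e) = ccomp hj' (face d hi a) (face d hi b) e';
  face_ccomp_gt : forall (d : side) n i j
      (hi : 1 <= i <= n.+2) (hj : 1 <= j <= n.+2) (hj' : 1 <= j <= n.+1)
      (a b : mag_reflexive n.+2) e e',
    j < i ->
    face d hi (ccomp hj a b e) = ccomp hj' (face d hi a) (face d hi b) e' }.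

Set Implicit Arguments.

Arguments ccomp {_ n j} _ _ _ _.

Record Mor (C D : CubicalMagma) := {
  mmap :> forall n, C n -> D n;
  mmap_face : forall (d : side) n j (h : 1 <= j <= n.+1) (x : C n.+1),
    mmap (face d h x) = face d h (mmap x);
  mmap_deg : forall n j (h : 1 <= j <= n.+1) (x : C n),
    mmap (deg h x) = deg h (mmap x);
  mmap_conn : forall (g : sign) n j (h : 1 <= j <= n) (x : C n),
    mmap (conn g h x) = conn g h (mmap x);
  mmap_ccomp : forall n j (h : 1 <= j <= n.+1) (a b : C n.+1) e e',
    mmap (ccomp h a b e) = ccomp h (mmap a) (mmap b) e' }.

Arguments mmap {C D} _ n _.

Record StrictCubicalCat := {
  scc_magma :> CubicalMagma;
  ccompA : forall n j (h : 1 <= j <= n.+1) (a b c : scc_magma n.+1) e1 e2 e3 e4,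
    ccomp h (ccomp h a b e1) c e2 = ccomp h a (ccomp h b c e3) e4;
  ccomp1l : forall n j (h : 1 <= j <= n.+1) (a : scc_magma n.+1) e,
    ccomp h (deg h (face Src h a)) a e = a;
  ccomp1r : forall n j (h : 1 <= j <= n.+1) (a : scc_magma n.+1) e,
    ccomp h a (deg h (face Tgt h a)) e = a;
  interchange : forall n i j (hi : 1 <= i <= n.+1) (hj : 1 <= j <= n.+1)
      (a b c d : scc_magma n.+1) e1 e2 e3 e4 e5 e6,
    i <> j ->
    ccomp hj (ccomp hi a b e1) (ccomp hi c d e2) e3 =
    ccomp hi (ccomp hj a c e4) (ccomp hj b d e5) e6;
  deg_ccomp_le : forall n i j (hi : 1 <= i <= n.+2)
      (hj : 1 <= j <= n.+1) (hj1 : 1 <= j.+1 <= n.+2)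
      (a b : scc_magma n.+1) e e',
    i <= j -> deg hi (ccomp hj a b e) = ccomp hj1 (deg hi a) (deg hi b) e';
  deg_ccomp_gt : forall n i j (hi : 1 <= i <= n.+2)
      (hj : 1 <= j <= n.+1) (hj' : 1 <= j <= n.+2)
      (a b : scc_magma n.+1) e e',
    j < i -> deg hi (ccomp hj a b e) = ccomp hj' (deg hi a) (deg hi b) e';
  conn_ccomp_lt : forall (g : sign) n i j (hi : 1 <= i <= n.+1)
      (hj : 1 <= j <= n.+1) (hj1 : 1 <= j.+1 <= n.+2)
      (a b : scc_magma n.+1) e e',
    i < j ->
    conn g hi (ccomp hj a b e) = ccomp hj1 (conn g hi a) (conn g hi b) e';
  conn_ccomp_gt : forall (g : sign) n i j (hi : 1 <= i <= n.+1)
      (hj : 1 <= j <= n.+1) (hj' : 1 <= j <= n.+2)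
      (a b : scc_magma n.+1) e e',
    j < i ->
    conn g hi (ccomp hj a b e) = ccomp hj' (conn g hi a) (conn g hi b) e';
  transportP : forall n j (h : 1 <= j <= n.+1)
      (hj : 1 <= j <= n.+2) (hj1 : 1 <= j.+1 <= n.+2)
      (a b : scc_magma n.+1) e e1 e2 e3,
    conn Plus h (ccomp h a b e) =
    ccomp hj1 (ccomp hj (conn Plus h a) (deg hj a) e1)
              (ccomp hj (deg hj1 a) (conn Plus h b) e2) e3;
  transportM : forall n j (h : 1 <= j <= n.+1)
      (hj : 1 <= j <= n.+2) (hj1 : 1 <= j.+1 <= n.+2)
      (a b : scc_magma n.+1) e e1 e2 e3,
    conn Minus h (ccomp h a b e) =
    ccomp hj1 (ccomp hj (conn Minus h a) (deg hj1 b) e1)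
              (ccomp hj (deg hj b) (conn Minus h b) e2) e3;
  connPM : forall n i (h : 1 <= i <= n)
      (hi : 1 <= i <= n.+1) (hi1 : 1 <= i.+1 <= n.+1) (x : scc_magma n) e,
    ccomp hi (conn Plus h x) (conn Minus h x) e = deg hi1 x;
  connPM1 : forall n i (h : 1 <= i <= n)
      (hi : 1 <= i <= n.+1) (hi1 : 1 <= i.+1 <= n.+1) (x : scc_magma n) e,
    ccomp hi1 (conn Plus h x) (conn Minus h x) e = deg hi x }.

Lemma Mor_ext (C D : CubicalMagma) (F G : Mor C D) :
  (forall n (x : C n), F n x = G n x) -> F = G.
Proof.
case: F => f f1 f2 f3 f4; case: G => g g1 g2 g3 g4 /= fg.
have {}fg : f = g.
  by apply: functional_extensionality_dep => n;
     apply: functional_extensionality_dep => x; apply: fg.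
by subst g; congr Build_Mor; apply: Prop_irrelevance.
Qed.

Definition mor_id (C : CubicalMagma) : Mor C C.
Proof.
exists (fun n x => x) => // n j h a b e e'.
by rewrite (Prop_irrelevance e e').
Defined.

Definition mor_comp (C D E : CubicalMagma) (G : Mor D E) (F : Mor C D) :
  Mor C E.
Proof.
exists (fun n x => G n (F n x)).
- by move=> *; rewrite !mmap_face.
- by move=> *; rewrite !mmap_deg.
- by move=> *; rewrite !mmap_conn.
move=> n j h a b e e'.
have e2 : face Tgt h (F _ a) = face Src h (F _ b) by rewrite -!mmap_face e.
by rewrite (mmap_ccomp e e2) (mmap_ccomp e2 e').
Defined.

Notation "G \m F" := (mor_comp G F) (at level 40, left associativity).

Record Category := {
  Ob :> Type;
  Hom : Ob -> Ob -> Type;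
  idc : forall x, Hom x x;
  cmpc : forall x y z, Hom y z -> Hom x y -> Hom x z;
  cmpcA : forall x y z w (h : Hom z w) (g : Hom y z) (f : Hom x y),
    cmpc h (cmpc g f) = cmpc (cmpc h g) f;
  cmp1c : forall x y (f : Hom x y), cmpc (idc y) f = f;
  cmpc1 : forall x y (f : Hom x y), cmpc f (idc x) = f }.

Arguments Hom {_} _ _.
Arguments idc {_} _.
Arguments cmpc {_ x y z} _ _.

Record Functor (A B : Category) := {
  fobj :> A -> B;
  fmap : forall x y, Hom x y -> Hom (fobj x) (fobj y);
  fmap_id : forall x, fmap (idc x) = idc (fobj x);
  fmap_cmp : forall x y z (g : Hom y z) (f : Hom x y),
    fmap (cmpc g f) = cmpc (fmap g) (fmap f) }.

Arguments fmap {A B} _ {x y} _.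

Definition func_id (A : Category) : Functor A A.
Proof. by exists (fun x => x) (fun _ _ f => f). Defined.

Definition func_comp (A B C : Category) (G : Functor B C) (F : Functor A B) :
  Functor A C.
Proof.
exists (fun x => G (F x)) (fun _ _ f => fmap G (fmap F f)).
- by move=> x; rewrite !fmap_id.
- by move=> *; rewrite !fmap_cmp.
Defined.

Notation "G \f F" := (func_comp G F) (at level 40, left associativity).

(* Arrows bundled with their ends: [Arrow f = Arrow g] is equality of arrows  *)
(* whose ends are only propositionally equal.                                 *)
Record arrow (A : Category) :=
  Arrow { adom : A; acod : A; ahom : Hom adom acod }.

Arguments Arrow {A adom acod} ahom.

Lemma Arrow_cmp (A : Category) (x y z x' y' z' : A)
    (g : Hom y z) (f : Hom x y) (g' : Hom y' z') (f' : Hom x' y') :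
  Arrow g = Arrow g' -> Arrow f = Arrow f' ->
  Arrow (cmpc g f) = Arrow (cmpc g' f').
Proof.
pose cmpa (u v : arrow A) (e : acod v = adom u) : arrow A :=
  Arrow (cmpc (ahom u) (eq_rect _ (fun w => Hom (adom v) w) (ahom v) _ e)).
move=> eg ef.
have cmpaE u u' v v' (e : acod v = adom u) (e' : acod v' = adom u') :
    u = u' -> v = v' -> cmpa u v e = cmpa u' v' e'.
  by move=> eu ev; subst; rewrite (Prop_irrelevance e e').
exact: (cmpaE (Arrow g) (Arrow g') (Arrow f) (Arrow f') erefl erefl eg ef).
Qed.

(* The pullback of F and G in CAT.                                            *)
Section Pullback.
Variables (A B C : Category) (F : Functor A C) (G : Functor B C).

Record pb_ob := PbOb { pb1 : A; pb2 : B; pb_eq : F pb1 = G pb2 }.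

Record pb_hom (p q : pb_ob) := PbHom {
  pbh1 : Hom (pb1 p) (pb1 q);
  pbh2 : Hom (pb2 p) (pb2 q);
  pbh_eq : Arrow (fmap F pbh1) = Arrow (fmap G pbh2) }.

Lemma pb_hom_ext p q (f g : pb_hom p q) :
  pbh1 f = pbh1 g -> pbh2 f = pbh2 g -> f = g.
Proof.
case: f => f1 f2 f3; case: g => g1 g2 g3 /= e1 e2; subst.
by rewrite (Prop_irrelevance f3 g3).
Qed.

Definition Pullback : Category.
Proof.
unshelve refine (@Build_Category pb_ob pb_hom _ _ _ _ _).
- move=> p; exists (idc _) (idc _).
  by rewrite !fmap_id (pb_eq p).
- move=> p q r g f; exists (cmpc (pbh1 g) (pbh1 f)) (cmpc (pbh2 g) (pbh2 f)).
  by rewrite !fmap_cmp; apply: Arrow_cmp; apply: pbh_eq.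
- by move=> *; apply: pb_hom_ext; rewrite /= cmpcA.
- by move=> *; apply: pb_hom_ext; rewrite /= cmp1c.
- by move=> *; apply: pb_hom_ext; rewrite /= cmpc1.
Defined.

Definition pairing (X : Category) (a : Functor X A) (b : Functor X B)
  (e : F \f a = G \f b) : Functor X Pullback.
Proof.
unshelve refine (@Build_Functor X Pullback
  (fun x => PbOb (f_equal (fun K : Functor X C => K x) e))
  (fun x y f => @PbHom (PbOb _) (PbOb _) (fmap a f) (fmap b f)
     (f_equal (fun K : Functor X C => Arrow (fmap K f)) e)) _ _).
- by move=> x; apply: pb_hom_ext; rewrite /= fmap_id.
- by move=> *; apply: pb_hom_ext; rewrite /= fmap_cmp.
Defined.

End Pullback.

(* For a composition functor m, [gcomp m a b e] is the composite of the       *)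
(* generalized elements a, b : X -> A.                                        *)
Definition gcomp (A C X : Category) (t s : Functor A C)
    (m : Functor (Pullback t s) A) (a b : Functor X A) (e : t \f a = s \f b) :
  Functor X A := m \f pairing e.

Arguments gcomp {A C X t s} m a b e.

(* Strict cubical 2-categories internal to CAT: s = s^1_{0,1}, s1 = s^2_{1,1}, *)
(* s2 = s^2_{1,2} (same for t), e0 = 1^0_{1,1}, e1 = 1^1_{2,1}, e2 =          *)
(* 1^1_{2,2}, cm = 1^{1,-}_{2,1}, cp = 1^{1,+}_{2,1}; m is the composition of *)
(* C1, m1 and m2 those of C2 in directions 1 and 2.  A law between composites *)
(* is an equality of functors on the limit of all composable configurations;  *)
(* it is stated on the cones a, b, ... : X -> C_n over that diagram, X being  *)
(* an arbitrary category (in particular the limit itself).                    *)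
Record is_strict_cubical_2cat (C0 C1 C2 : Category)
    (s t : Functor C1 C0) (s1 s2 t1 t2 : Functor C2 C1)
    (e0 : Functor C0 C1) (e1 e2 cm cp : Functor C1 C2)
    (m : Functor (Pullback t s) C1)
    (m1 : Functor (Pullback t1 s1) C2)
    (m2 : Functor (Pullback t2 s2) C2) : Prop := {
  sc2_ss : s \f s2 = s \f s1;
  sc2_st : s \f t2 = t \f s1;
  sc2_ts : t \f s2 = s \f t1;
  sc2_tt : t \f t2 = t \f t1;

  sc2_e1e0 : e1 \f e0 = e2 \f e0;
  sc2_se0 : s \f e0 = func_id C0;
  sc2_te0 : t \f e0 = func_id C0;
  sc2_s1e1 : s1 \f e1 = func_id C1;
  sc2_t1e1 : t1 \f e1 = func_id C1;
  sc2_s2e2 : s2 \f e2 = func_id C1;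
  sc2_t2e2 : t2 \f e2 = func_id C1;
  sc2_s1e2 : s1 \f e2 = e0 \f s;
  sc2_t1e2 : t1 \f e2 = e0 \f t;
  sc2_s2e1 : s2 \f e1 = e0 \f s;
  sc2_t2e1 : t2 \f e1 = e0 \f t;

  sc2_cme0 : cm \f e0 = e1 \f e0;
  sc2_cpe0 : cp \f e0 = e1 \f e0;
  sc2_s1cm : s1 \f cm = func_id C1;
  sc2_s2cm : s2 \f cm = func_id C1;
  sc2_t1cp : t1 \f cp = func_id C1;
  sc2_t2cp : t2 \f cp = func_id C1;
  sc2_s1cp : s1 \f cp = e0 \f s;
  sc2_s2cp : s2 \f cp = e0 \f s;
  sc2_t1cm : t1 \f cm = e0 \f t;
  sc2_t2cm : t2 \f cm = e0 \f t;

  sc2_sm : forall X (a b : Functor X C1) h, s \f gcomp m a b h = s \f a;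
  sc2_tm : forall X (a b : Functor X C1) h, t \f gcomp m a b h = t \f b;
  sc2_s1m1 : forall X (a b : Functor X C2) h, s1 \f gcomp m1 a b h = s1 \f a;
  sc2_t1m1 : forall X (a b : Functor X C2) h, t1 \f gcomp m1 a b h = t1 \f b;
  sc2_s2m2 : forall X (a b : Functor X C2) h, s2 \f gcomp m2 a b h = s2 \f a;
  sc2_t2m2 : forall X (a b : Functor X C2) h, t2 \f gcomp m2 a b h = t2 \f b;
  sc2_s1m2 : forall X (a b : Functor X C2) h h',
    s1 \f gcomp m2 a b h = gcomp m (s1 \f a) (s1 \f b) h';
  sc2_t1m2 : forall X (a b : Functor X C2) h h',
    t1 \f gcomp m2 a b h = gcomp m (t1 \f a) (t1 \f b) h';
  sc2_s2m1 : forall X (a b : Functor X C2) h h',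
    s2 \f gcomp m1 a b h = gcomp m (s2 \f a) (s2 \f b) h';
  sc2_t2m1 : forall X (a b : Functor X C2) h h',
    t2 \f gcomp m1 a b h = gcomp m (t2 \f a) (t2 \f b) h';

  sc2_mA : forall X (a b c : Functor X C1) h1 h2 h3 h4,
    gcomp m (gcomp m a b h1) c h2 = gcomp m a (gcomp m b c h3) h4;
  sc2_m1A : forall X (a b c : Functor X C2) h1 h2 h3 h4,
    gcomp m1 (gcomp m1 a b h1) c h2 = gcomp m1 a (gcomp m1 b c h3) h4;
  sc2_m2A : forall X (a b c : Functor X C2) h1 h2 h3 h4,
    gcomp m2 (gcomp m2 a b h1) c h2 = gcomp m2 a (gcomp m2 b c h3) h4;
  sc2_m1l : forall X (a : Functor X C1) h, gcomp m (e0 \f (s \f a)) a h = a;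
  sc2_m1r : forall X (a : Functor X C1) h, gcomp m a (e0 \f (t \f a)) h = a;
  sc2_m11l : forall X (a : Functor X C2) h, gcomp m1 (e1 \f (s1 \f a)) a h = a;
  sc2_m11r : forall X (a : Functor X C2) h, gcomp m1 a (e1 \f (t1 \f a)) h = a;
  sc2_m21l : forall X (a : Functor X C2) h, gcomp m2 (e2 \f (s2 \f a)) a h = a;
  sc2_m21r : forall X (a : Functor X C2) h, gcomp m2 a (e2 \f (t2 \f a)) h = a;

  sc2_interchange : forall X (a b c d : Functor X C2) h1 h2 h3 h4 h5 h6,
    gcomp m2 (gcomp m1 a b h1) (gcomp m1 c d h2) h3 =
    gcomp m1 (gcomp m2 a c h4) (gcomp m2 b d h5) h6;
  sc2_e1m : forall X (a b : Functor X C1) h h',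
    e1 \f gcomp m a b h = gcomp m2 (e1 \f a) (e1 \f b) h';
  sc2_e2m : forall X (a b : Functor X C1) h h',
    e2 \f gcomp m a b h = gcomp m1 (e2 \f a) (e2 \f b) h';
  sc2_transportP : forall X (a b : Functor X C1) h h1 h2 h3,
    cp \f gcomp m a b h =
    gcomp m2 (gcomp m1 (cp \f a) (e1 \f a) h1)
             (gcomp m1 (e2 \f a) (cp \f b) h2) h3;
  sc2_transportM : forall X (a b : Functor X C1) h h1 h2 h3,
    cm \f gcomp m a b h =
    gcomp m2 (gcomp m1 (cm \f a) (e2 \f b) h1)
             (gcomp m1 (e1 \f b) (cm \f b) h2) h3;
  sc2_cpm1cm : forall X (x : Functor X C1) h,
    gcomp m1 (cp \f x) (cm \f x) h = e2 \f x;
  sc2_cpm2cm : forall X (x : Functor X C1) h,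
    gcomp m2 (cp \f x) (cm \f x) h = e1 \f x }.

Arguments is_strict_cubical_2cat {C0 C1 C2} s t s1 s2 t1 t2 e0 e1 e2 cm cp m m1 m2.

Definition CCAT : Category.
Proof.
unshelve refine (@Build_Category StrictCubicalCat
  (fun C D => Mor C D) (fun C => mor_id C) (fun _ _ _ G F => G \m F) _ _ _);
  by move=> *; apply: Mor_ext.
Defined.

Record CFunct_ob := CFunctOb {
  fdom : StrictCubicalCat; fcod : StrictCubicalCat; ffun : Mor fdom fcod }.

Record CFunct_hom (F F' : CFunct_ob) := CFunctHom {
  hdom : Mor (fdom F) (fdom F');
  hcod : Mor (fcod F) (fcod F');
  hsq : hcod \m ffun F = ffun F' \m hdom }.

Lemma CFunct_hom_ext F F' (f g : CFunct_hom F F') :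
  hdom f = hdom g -> hcod f = hcod g -> f = g.
Proof.
case: f => f1 f2 f3; case: g => g1 g2 g3 /= e1 e2; subst.
by rewrite (Prop_irrelevance f3 g3).
Qed.

Lemma mor_compA (A B C D : CubicalMagma)
    (H : Mor C D) (G : Mor B C) (F : Mor A B) :
  H \m (G \m F) = H \m G \m F.
Proof. exact: Mor_ext. Qed.

Lemma mor_comp1l (A B : CubicalMagma) (F : Mor A B) : mor_id B \m F = F.
Proof. exact: Mor_ext. Qed.

Lemma mor_comp1r (A B : CubicalMagma) (F : Mor A B) : F \m mor_id A = F.
Proof. exact: Mor_ext. Qed.

Lemma mor_sq_comp (A B A' B' A'' B'' : CubicalMagma)
    (F : Mor A B) (F' : Mor A' B') (F'' : Mor A'' B'')
    (c : Mor A A') (d : Mor B B') (c' : Mor A' A'') (d' : Mor B' B'') :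
  d \m F = F' \m c -> d' \m F' = F'' \m c' ->
  (d' \m d) \m F = F'' \m (c' \m c).
Proof. by move=> e e'; rewrite -mor_compA e mor_compA e' -mor_compA. Qed.

Definition CFUNCT : Category.
Proof.
unshelve refine (@Build_Category CFunct_ob CFunct_hom _ _ _ _ _).
- by move=> F; exists (mor_id _) (mor_id _); apply: Mor_ext.
- move=> F G H g f; exists (hdom g \m hdom f) (hcod g \m hcod f).
  exact: mor_sq_comp (hsq f) (hsq g).
- by move=> *; apply: CFunct_hom_ext; apply: mor_compA.
- by move=> *; apply: CFunct_hom_ext; apply: mor_comp1l.
- by move=> *; apply: CFunct_hom_ext; apply: mor_comp1r.
Defined.

Definition dir1 : 1 <= 1 <= 1 := isT.

Record CTrans_ob := {
  C00 : StrictCubicalCat; C10 : StrictCubicalCat;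
  C01 : StrictCubicalCat; C11 : StrictCubicalCat;
  tr_top : Mor C00 C10;
  tr_right : Mor C10 C11;
  tr_left : Mor C00 C01;
  tr_bottom : Mor C01 C11;
  trans : C00 0 -> C11 1;
  trans_src : forall a, face Src dir1 (trans a) = tr_right 0 (tr_top 0 a);
  trans_tgt : forall a, face Tgt dir1 (trans a) = tr_bottom 0 (tr_left 0 a);
  trans_nat : forall (f : C00 1) e e',
    ccomp dir1 (tr_right 1 (tr_top 1 f)) (trans (face Tgt dir1 f)) e =
    ccomp dir1 (trans (face Src dir1 f)) (tr_bottom 1 (tr_left 1 f)) e' }.

Arguments trans : clear implicits.

Record CTrans_hom (u v : CTrans_ob) := {
  c00 : Mor (C00 u) (C00 v);
  c10 : Mor (C10 u) (C10 v);
  c01 : Mor (C01 u) (C01 v);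
  c11 : Mor (C11 u) (C11 v);
  c_top : c10 \m tr_top u = tr_top v \m c00;
  c_right : c11 \m tr_right u = tr_right v \m c10;
  c_left : c01 \m tr_left u = tr_left v \m c00;
  c_bottom : c11 \m tr_bottom u = tr_bottom v \m c01;
  c_trans : forall a, c11 1 (trans u a) = trans v (c00 0 a) }.

Lemma CTrans_hom_ext u v (f g : CTrans_hom u v) :
  c00 f = c00 g -> c10 f = c10 g -> c01 f = c01 g -> c11 f = c11 g -> f = g.
Proof.
case: f => f1 f2 f3 f4 p1 p2 p3 p4 p5; case: g => g1 g2 g3 g4 q1 q2 q3 q4 q5 /=.
by move=> e1 e2 e3 e4; subst; congr Build_CTrans_hom; apply: Prop_irrelevance.
Qed.

Definition CTRANS : Category.
Proof.
unshelve refine (@Build_Category CTrans_ob CTrans_hom _ _ _ _ _).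
- by move=> u; exists (mor_id _) (mor_id _) (mor_id _) (mor_id _);
     try apply: Mor_ext.
- move=> u v w g f.
  exists (c00 g \m c00 f) (c10 g \m c10 f) (c01 g \m c01 f) (c11 g \m c11 f).
  + exact: mor_sq_comp (c_top f) (c_top g).
  + exact: mor_sq_comp (c_right f) (c_right g).
  + exact: mor_sq_comp (c_left f) (c_left g).
  + exact: mor_sq_comp (c_bottom f) (c_bottom g).
  + by move=> a; rewrite /= !c_trans.
- by move=> *; apply: CTrans_hom_ext; apply: mor_compA.
- by move=> *; apply: CTrans_hom_ext; apply: mor_comp1l.
- by move=> *; apply: CTrans_hom_ext; apply: mor_comp1r.
Defined.

Definition sigma10 : Functor CFUNCT CCAT.
Proof. by exists (fdom : CFUNCT -> CCAT) hdom. Defined.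

Definition tau10 : Functor CFUNCT CCAT.
Proof. by exists (fcod : CFUNCT -> CCAT) hcod. Defined.

Definition sigma21_1 : Functor CTRANS CFUNCT.
Proof.
by exists (fun u : CTRANS => CFunctOb (tr_top u) : CFUNCT)
  (fun u v f => @CFunctHom (CFunctOb (tr_top u)) (CFunctOb (tr_top v)) _ _ (c_top f));
  move=> *; apply: CFunct_hom_ext.
Defined.

Definition sigma21_2 : Functor CTRANS CFUNCT.
Proof.
by exists (fun u : CTRANS => CFunctOb (tr_left u) : CFUNCT)
  (fun u v f => @CFunctHom (CFunctOb (tr_left u)) (CFunctOb (tr_left v)) _ _ (c_left f));
  move=> *; apply: CFunct_hom_ext.
Defined.

Definition tau21_1 : Functor CTRANS CFUNCT.
Proof.
by exists (fun u : CTRANS => CFunctOb (tr_bottom u) : CFUNCT)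
  (fun u v f => @CFunctHom (CFunctOb (tr_bottom u)) (CFunctOb (tr_bottom v)) _ _ (c_bottom f));
  move=> *; apply: CFunct_hom_ext.
Defined.

Definition tau21_2 : Functor CTRANS CFUNCT.
Proof.
by exists (fun u : CTRANS => CFunctOb (tr_right u) : CFUNCT)
  (fun u v f => @CFunctHom (CFunctOb (tr_right u)) (CFunctOb (tr_right v)) _ _ (c_right f));
  move=> *; apply: CFunct_hom_ext.
Defined.

(* Main.v *)
From mathcomp Require Import all_boot.
From mathcomp Require Import boolp.
Require Import Defs.

(** A transformation tau is a square of functors with 1-cells
    tau a : G (F a) -> K (H a), natural in the 1-cells of C00.  Identity functors
    and composition of functors structure dimensions 0 and 1.  In dimension 2,
    each commuting square G F = K H carries an identity transformation
    (thin_square); the two reflexions and the two connections of F are the four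
    such squares with two edges F and two identity edges.  Composition is
    pasting: vertically (paste_v) the component at a is G' (tau a) followed by
    tau' (H a), horizontally (paste_h) it is tau' (F a) followed by K' (tau a).

    Associativity and unit laws come from those of the composition of 1-cells.
    Interchange is the only law whose proof uses naturality: in a 2 x 2 grid both
    composites run through the lower right transformation d, one before and one
    after crossing the component of the upper left one, and naturality of d at
    that component identifies them (paste_interchange).  Every law relating
    reflexions, connections and compositions equates two transformations with
    identity components, since these are stable under pasting; such a
    transformation is determined by its four faces (thin_ext), so only
    equalities between functors remain.

    Composability is an equality between objects of a large category, so the
    composites involve transports.  These are treated as comparison functors
    (mcast), and pasting is done along an arbitrary comparison square.  The
    equations between arrows involve no transport: an arrow of CTRANS with given
    ends is determined by its components at the four corners, and the corners of
    a composite are corners of its factors; hence a law between functors reduces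
    to objects (CTRANS_functor_ext). *)

Set Implicit Arguments.
Unset Strict Implicit.
Unset Printing Implicit Defensive.

(** * Equality of functors *)

Lemma Arrow_inj (A : Category) (a b : A) (u v : Hom a b) :
  Arrow u = Arrow v -> u = v.
Proof.
(* The arrow p, read in Hom a b along proofs that a and b are its ends. *)
pose re (p : arrow A) (e1 : adom p = a) (e2 : acod p = b) : Hom a b :=
  eq_rect _ (Hom a) (eq_rect _ (fun z => Hom z _) (ahom p) _ e1) _ e2.
move=> e; have E p q e1 e2 e1' e2' : p = q -> re p e1 e2 = re q e1' e2'.
  by move=> epq; subst q; congr re; apply: Prop_irrelevance.
exact: (E (Arrow u) (Arrow v) erefl erefl erefl erefl e).
Qed.

Lemma Functor_ext (A B : Category) (F G : Functor A B) :
  (forall x, F x = G x) ->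
  (forall x y (f : Hom x y), Arrow (fmap F f) = Arrow (fmap G f)) -> F = G.
Proof.
case: F => F0 F1 F2 F3; case: G => G0 G1 G2 G3 /= E0 E1.
have {}E0 : F0 = G0 by apply: functional_extensionality_dep.
subst G0; have E : F1 = G1.
  apply: functional_extensionality_dep => x.
  apply: functional_extensionality_dep => y.
  by apply: functional_extensionality_dep => f; apply: Arrow_inj.
by subst G1; congr Build_Functor; apply: Prop_irrelevance.
Qed.

(** An arrow of CFUNCT with given ends is determined by two arrows of CCAT, so
    once the objects agree it is enough to compare CCAT-valued functors.  In the
    laws of a cubical 2-category these comparisons hold by computation. *)
Lemma CFUNCT_functor_ext (X : Category) (F G : Functor X CFUNCT) :
  (forall x, F x = G x) ->
  sigma10 \f F = sigma10 \f G -> tau10 \f F = tau10 \f G -> F = G.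
Proof.
move=> E0 Ed Ec; apply: Functor_ext => // x y f.
have {}Ed := f_equal (fun K : Functor X CCAT => Arrow (fmap K f)) Ed.
have {}Ec := f_equal (fun K : Functor X CCAT => Arrow (fmap K f)) Ec.
move: Ed Ec => /=; move: (fmap F f) (fmap G f); rewrite !E0 => u v Ed Ec.
by congr Arrow; apply: CFunct_hom_ext;
   [apply: (@Arrow_inj CCAT) Ed | apply: (@Arrow_inj CCAT) Ec].
Qed.

(** Likewise an arrow of CTRANS is determined by its four corners. *)
Lemma CTRANS_functor_ext (X : Category) (F G : Functor X CTRANS) :
  (forall x, F x = G x) ->
  sigma10 \f (sigma21_1 \f F) = sigma10 \f (sigma21_1 \f G) ->
  tau10 \f (sigma21_1 \f F) = tau10 \f (sigma21_1 \f G) ->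
  sigma10 \f (tau21_1 \f F) = sigma10 \f (tau21_1 \f G) ->
  tau10 \f (tau21_1 \f F) = tau10 \f (tau21_1 \f G) -> F = G.
Proof.
move=> E0 E00 E10 E01 E11; apply: Functor_ext => // x y f.
have fE K L : K = L -> Arrow (fmap K f) = Arrow (fmap L f) :> arrow CCAT.
  by move=> ->.
move: (fE _ _ E00) (fE _ _ E10) (fE _ _ E01) (fE _ _ E11) => /=.
move: (fmap F f) (fmap G f); rewrite !E0 => u v.
move=> {}E00 {}E10 {}E01 {}E11; congr Arrow.
by apply: CTrans_hom_ext; apply: (@Arrow_inj CCAT).
Qed.

(** * One-dimensional composition in a strict cubical category *)

Lemma ccomp_congr (C : CubicalMagma) n j (h : 1 <= j <= n.+1)
    (a b a' b' : C n.+1) e e' :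
  a = a' -> b = b' -> ccomp h a b e = ccomp h a' b' e'.
Proof. by move=> ea eb; subst; rewrite (Prop_irrelevance e e'). Qed.

Lemma mmap_ccomp_congr (C D : CubicalMagma) (F : Mor C D) n j
    (h : 1 <= j <= n.+1) (a b : C n.+1) (a' b' : D n.+1) e e' :
  F _ a = a' -> F _ b = b' -> F _ (ccomp h a b e) = ccomp h a' b' e'.
Proof. by move=> ea eb; subst; apply: mmap_ccomp. Qed.

Lemma mmap_composable (C D : CubicalMagma) (F : Mor C D) n j
    (h : 1 <= j <= n.+1) (a b : C n.+1) :
  face Tgt h a = face Src h b -> face Tgt h (F _ a) = face Src h (F _ b).
Proof. by rewrite -!mmap_face => ->. Qed.

Lemma mmap_ccompE (C D : CubicalMagma) (F : Mor C D) n j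
    (h : 1 <= j <= n.+1) (a b : C n.+1) e :
  F _ (ccomp h a b e) = ccomp h (F _ a) (F _ b) (mmap_composable F e).
Proof. exact: mmap_ccomp. Qed.

Lemma mmap_ccompAl (C D : StrictCubicalCat) (F : Mor C D) n j
    (h : 1 <= j <= n.+1) (a b : C n.+1) (c : D n.+1) e1 e2 e3 e4 :
  ccomp h (F _ (ccomp h a b e1)) c e2 =
  ccomp h (F _ a) (ccomp h (F _ b) c e3) e4.
Proof. by move: e2; rewrite mmap_ccompE => e2; apply: ccompA. Qed.

Lemma mmap_ccompAr (C D : StrictCubicalCat) (F : Mor C D) n j
    (h : 1 <= j <= n.+1) (a : D n.+1) (b c : C n.+1) e1 e2 e3 e4 :
  ccomp h (ccomp h a (F _ b) e1) (F _ c) e2 =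
  ccomp h a (F _ (ccomp h b c e3)) e4.
Proof. by move: e4; rewrite mmap_ccompE => e4; apply: ccompA. Qed.

(** By associativity a composite of four cells depends on its two middle cells
    only through their composite. *)
Lemma ccomp_exchange (C : StrictCubicalCat) n j (h : 1 <= j <= n.+1)
    (a b c d b' c' x y x' y' : C n.+1) e1 e2 e3 e4 e5 e6 e7 e8 :
  ccomp h b c e1 = ccomp h b' c' e2 ->
  x = ccomp h a b e3 -> y = ccomp h c d e4 ->
  x' = ccomp h a b' e5 -> y' = ccomp h c' d e6 ->
  ccomp h x y e7 = ccomp h x' y' e8.
Proof.
move=> E ? ? ? ?; subst x y x' y'.
have assoc4 x y e e' e'' (exy : face Tgt h x = face Src h y) :
    exists f g, ccomp h (ccomp h a x e) (ccomp h y d e') e'' =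
      ccomp h a (ccomp h (ccomp h x y exy) d f) g.
  have f : face Tgt h (ccomp h x y exy) = face Src h d by rewrite tgt_ccomp e'.
  have g : face Tgt h a = face Src h (ccomp h (ccomp h x y exy) d f).
    by rewrite !src_ccomp e.
  have g' : face Tgt h x = face Src h (ccomp h y d e') by rewrite src_ccomp.
  have g'' : face Tgt h a = face Src h (ccomp h x (ccomp h y d e') g').
    by rewrite src_ccomp.
  exists f, g; rewrite (@ccompA _ _ _ h a x _ e e'' g' g'').
  by apply: ccomp_congr => //; rewrite (@ccompA _ _ _ h x y d exy f e' g').
have [f1 [g1 ->]] := assoc4 _ _ e3 e4 e7 e1.
have [f2 [g2 ->]] := assoc4 _ _ e5 e6 e8 e2.
by do 2!apply: ccomp_congr => //.
Qed.

(** Two commutative squares sharing the edge g compose to a commutative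
    rectangle. *)
Lemma square_paste (C : StrictCubicalCat) n j (h : 1 <= j <= n.+1)
    (f a b g c d k : C n.+1) e1 e2 e3 e4 e5 e6 e7 e8 :
  ccomp h f b e1 = ccomp h a g e2 -> ccomp h g d e3 = ccomp h c k e4 ->
  ccomp h f (ccomp h b d e5) e6 = ccomp h (ccomp h a c e7) k e8.
Proof.
move=> E1 E2.
have e9 : face Tgt h (ccomp h f b e1) = face Src h d by rewrite tgt_ccomp e5.
have e10 : face Tgt h a = face Src h (ccomp h g d e3) by rewrite src_ccomp.
have e11 : face Tgt h (ccomp h a g e2) = face Src h d by rewrite -E1.
have e12 : face Tgt h a = face Src h (ccomp h c k e4) by rewrite -E2.
rewrite -(@ccompA _ _ _ h f b d e1 e9) (ccomp_congr (h := h) e9 e11 E1 erefl).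
rewrite (@ccompA _ _ _ h a g d e2 e11 e3 e10).
rewrite (@ccompA _ _ _ h a c k e7 e8 e4 e12).
exact: ccomp_congr.
Qed.

Lemma ccomp_deg_l (C : StrictCubicalCat) n j (h : 1 <= j <= n.+1)
    (x : C n) (a : C n.+1) e : ccomp h (deg h x) a e = a.
Proof.
have e' : face Tgt h (deg h (face Src h a)) = face Src h a.
  by rewrite face_deg_eq.
rewrite -[RHS](ccomp1l e'); apply: ccomp_congr => //.
by rewrite -e face_deg_eq.
Qed.

Lemma ccomp_deg_r (C : StrictCubicalCat) n j (h : 1 <= j <= n.+1)
    (x : C n) (a : C n.+1) e : ccomp h a (deg h x) e = a.
Proof.
have e' : face Tgt h a = face Src h (deg h (face Tgt h a)).
  by rewrite face_deg_eq.
rewrite -[RHS](ccomp1r e'); apply: ccomp_congr => //.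
by rewrite e face_deg_eq.
Qed.

Lemma mor_sqE (A B B' D : CubicalMagma) (F : Mor A B) (G : Mor B D)
    (H : Mor A B') (K : Mor B' D) n (x : A n) :
  G \m F = K \m H -> G n (F n x) = K n (H n x).
Proof. by move=> /(f_equal (fun M : Mor A D => M n x)). Qed.

(** * Commuting squares as transformations *)

Section ThinSquare.
Variables (A B C D : StrictCubicalCat).
Variables (F : Mor A B) (G : Mor B D) (H : Mor A C) (K : Mor C D).
Hypothesis E : G \m F = K \m H.

Lemma thin_square_tgt a :
  face Tgt dir1 (deg dir1 (G 0 (F 0 a))) = K 0 (H 0 a).
Proof. by rewrite face_deg_eq (mor_sqE _ E). Qed.

Lemma thin_square_nat (f : A 1) e e' :
  ccomp dir1 (G 1 (F 1 f)) (deg dir1 (G 0 (F 0 (face Tgt dir1 f)))) e =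
  ccomp dir1 (deg dir1 (G 0 (F 0 (face Src dir1 f)))) (K 1 (H 1 f)) e'.
Proof. by rewrite ccomp_deg_r ccomp_deg_l (mor_sqE _ E). Qed.

(** The identity transformation of the commuting square G F = K H.  Reflexions
    and connections in dimension 2 are of this form. *)
Definition thin_square : CTrans_ob :=
  Build_CTrans_ob (fun a => face_deg_eq Src dir1 (G 0 (F 0 a)))
    thin_square_tgt thin_square_nat.

End ThinSquare.

Definition thin (u : CTrans_ob) : Prop :=
  forall a, trans u a = deg dir1 (tr_right u 0 (tr_top u 0 a)).

Lemma thin_thin_square (A B C D : StrictCubicalCat) (F : Mor A B)
    (G : Mor B D) (H : Mor A C) (K : Mor C D) (E : G \m F = K \m H) :
  thin (thin_square E).
Proof. by []. Qed.

(** The four categories are shared by both sides: every use below has them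
    convertible, which avoids comparing cells of different types. *)
Lemma CTrans_ob_ext (A B C D : StrictCubicalCat)
    (F F' : Mor A B) (G G' : Mor B D) (H H' : Mor A C) (K K' : Mor C D)
    tau tau' p q r p' q' r' :
  F = F' -> G = G' -> H = H' -> K = K' -> (forall a, tau a = tau' a) ->
  @Build_CTrans_ob A B C D F G H K tau p q r =
  @Build_CTrans_ob A B C D F' G' H' K' tau' p' q' r'.
Proof.
move=> eF eG eH eK et; have {}et : tau = tau'.
  exact: functional_extensionality_dep.
by subst; congr Build_CTrans_ob; apply: Prop_irrelevance.
Qed.

(** * Pasting *)

Lemma mmap_trans_nat (u : CTrans_ob) (D : StrictCubicalCat)
    (M : Mor (C11 u) D) (f : C00 u 1) e e' :
  ccomp dir1 (M 1 (tr_right u 1 (tr_top u 1 f)))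
             (M 1 (trans u (face Tgt dir1 f))) e =
  ccomp dir1 (M 1 (trans u (face Src dir1 f)))
             (M 1 (tr_bottom u 1 (tr_left u 1 f))) e'.
Proof.
have n1 : face Tgt dir1 (tr_right u 1 (tr_top u 1 f)) =
          face Src dir1 (trans u (face Tgt dir1 f)).
  by rewrite -!mmap_face trans_src.
have n2 : face Tgt dir1 (trans u (face Src dir1 f)) =
          face Src dir1 (tr_bottom u 1 (tr_left u 1 f)).
  by rewrite -!mmap_face trans_tgt.
by rewrite -(mmap_ccomp n1) -(mmap_ccomp n2) (trans_nat n1 n2).
Qed.

Section Pasting.
Variables u v : CTrans_ob.

Section Vertical.
Variables (P : Mor (C01 u) (C00 v)) (Q : Mor (C11 u) (C10 v)).
Hypothesis E : Q \m tr_bottom u = tr_top v \m P.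

Lemma paste_v_composable a :
  face Tgt dir1 (tr_right v 1 (Q 1 (trans u a))) =
  face Src dir1 (trans v (P 0 (tr_left u 0 a))).
Proof. by rewrite -!mmap_face trans_tgt trans_src (mor_sqE _ E). Qed.

Let tau a := ccomp dir1 _ _ (paste_v_composable a).

Lemma paste_v_src a :
  face Src dir1 (tau a) = (tr_right v \m Q \m tr_right u) 0 (tr_top u 0 a).
Proof. by rewrite src_ccomp -!mmap_face trans_src. Qed.

Lemma paste_v_tgt a :
  face Tgt dir1 (tau a) = tr_bottom v 0 ((tr_left v \m P \m tr_left u) 0 a).
Proof. by rewrite tgt_ccomp trans_tgt. Qed.

Lemma paste_v_nat (f : C00 u 1) e e' :
  ccomp dir1 ((tr_right v \m Q \m tr_right u) 1 (tr_top u 1 f))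
             (tau (face Tgt dir1 f)) e =
  ccomp dir1 (tau (face Src dir1 f))
             (tr_bottom v 1 ((tr_left v \m P \m tr_left u) 1 f)) e'.
Proof.
have E1 e1 e2 := mmap_trans_nat (M := tr_right v \m Q) (f := f) e1 e2.
have E2 := @trans_nat v (P 1 (tr_left u 1 f)).
rewrite /= -(mor_sqE _ E) -!(mmap_face P) -!(mmap_face (tr_left u)) in E1 E2.
unshelve refine (square_paste e e' (E1 _ _) (E2 _ _)).
- by rewrite -!mmap_face trans_src.
- by rewrite -!mmap_face trans_tgt.
- by rewrite -!mmap_face trans_src (mor_sqE _ E).
- by rewrite -!mmap_face trans_tgt.
Qed.

(** Vertical pasting along a comparison (P, Q) of the facing edges instead of an
    equality between them.  Transport along an equality is then only one choice
    of P and Q, and the laws of pasting are proved without transport. *)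
Definition paste_v : CTrans_ob :=
  Build_CTrans_ob paste_v_src paste_v_tgt paste_v_nat.

End Vertical.

Section Horizontal.
Variables (P : Mor (C10 u) (C00 v)) (Q : Mor (C11 u) (C01 v)).
Hypothesis E : Q \m tr_right u = tr_left v \m P.

Lemma paste_h_composable a :
  face Tgt dir1 (trans v (P 0 (tr_top u 0 a))) =
  face Src dir1 (tr_bottom v 1 (Q 1 (trans u a))).
Proof. by rewrite -!mmap_face trans_tgt trans_src (mor_sqE _ E). Qed.

Let tau a := ccomp dir1 _ _ (paste_h_composable a).

Lemma paste_h_src a :
  face Src dir1 (tau a) = tr_right v 0 ((tr_top v \m P \m tr_top u) 0 a).
Proof. by rewrite src_ccomp trans_src. Qed.

Lemma paste_h_tgt a :
  face Tgt dir1 (tau a) = (tr_bottom v \m Q \m tr_bottom u) 0 (tr_left u 0 a).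
Proof. by rewrite tgt_ccomp -!mmap_face trans_tgt. Qed.

Lemma paste_h_nat (f : C00 u 1) e e' :
  ccomp dir1 (tr_right v 1 ((tr_top v \m P \m tr_top u) 1 f))
             (tau (face Tgt dir1 f)) e =
  ccomp dir1 (tau (face Src dir1 f))
             ((tr_bottom v \m Q \m tr_bottom u) 1 (tr_left u 1 f)) e'.
Proof.
have E1 := @trans_nat v (P 1 (tr_top u 1 f)).
have E2 e1 e2 := mmap_trans_nat (M := tr_bottom v \m Q) (f := f) e1 e2.
rewrite /= -(mor_sqE _ E) -!(mmap_face P) -!(mmap_face (tr_top u)) in E1 E2.
unshelve refine (square_paste e e' (E1 _ _) (E2 _ _)).
- by rewrite -!mmap_face trans_src.
- by rewrite -!mmap_face trans_tgt (mor_sqE _ E).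
- by rewrite -!mmap_face trans_src.
- by rewrite -!mmap_face trans_tgt.
Qed.

(** Horizontal pasting.  The component of v comes first here: the 1-cells of a
    transformation go from right after top to bottom after left. *)
Definition paste_h : CTrans_ob :=
  Build_CTrans_ob paste_h_src paste_h_tgt paste_h_nat.

End Horizontal.
End Pasting.

Lemma paste_vA u v w P Q E P' Q' E' E1 E2 :
  @paste_v (@paste_v u v P Q E) w P' Q' E1 =
  @paste_v u (@paste_v v w P' Q' E') P Q E2.
Proof.
apply: CTrans_ob_ext => //; try exact: Mor_ext.
move=> a; exact: (mmap_ccompAl (F := tr_right w \m Q')).
Qed.

Lemma paste_hA u v w P Q E P' Q' E' E1 E2 :
  @paste_h (@paste_h u v P Q E) w P' Q' E1 =
  @paste_h u (@paste_h v w P' Q' E') P Q E2.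
Proof.
apply: CTrans_ob_ext => //; try exact: Mor_ext.
move=> a; apply: esym; exact: (mmap_ccompAr (F := tr_bottom w \m Q')).
Qed.

(** Both sides compose four 1-cells, of which only the middle two differ: they
    are the two sides of the naturality square of d at the component of a, seen
    as a 1-cell of C00 d.  It can be carried there through b or through c, and
    the hypothesis says that these two ways agree. *)
Lemma paste_interchange a b c d Pab Qab Eab Pcd Qcd Ecd
    Pac Qac Eac Pbd Qbd Ebd Eh Ev :
  Pbd \m Qab = Pcd \m Qac ->
  @paste_h (@paste_v a b Pab Qab Eab) (@paste_v c d Pcd Qcd Ecd) Pac Qbd Eh =
  @paste_v (@paste_h a c Pac Qac Eac) (@paste_h b d Pbd Qbd Ebd) Pab Qcd Ev.
Proof.
move=> E; apply: CTrans_ob_ext => //; try exact: Mor_ext.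
move=> x /=.
set f := Pbd 1 (Qab 1 (trans a x)).
have ft : face Tgt dir1 f = Pbd 0 (tr_top b 0 (Pab 0 (tr_left a 0 x))).
  by rewrite -!mmap_face trans_tgt (mor_sqE _ Eab).
have fs : face Src dir1 f = Pcd 0 (tr_left c 0 (Pac 0 (tr_top a 0 x))).
  by rewrite -(mor_sqE _ Eac) -(mor_sqE _ E) -!mmap_face trans_src.
have N := @trans_nat d f.
have fF : tr_top d 1 f = Qcd 1 (tr_bottom c 1 (Qac 1 (trans a x))).
  by rewrite (mor_sqE _ Ecd) -(mor_sqE _ E).
have fH : tr_left d 1 f = Qbd 1 (tr_right b 1 (Qab 1 (trans a x))).
  by rewrite -(mor_sqE _ Ebd).
clearbody f; rewrite ft fs fF fH in N.
unshelve refine (ccomp_exchange _ _ (esym (N _ _)) erefl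
  (mmap_ccompE (tr_bottom d \m Qbd) _)
  (mmap_ccompE (tr_right d \m Qcd) _) erefl).
- by rewrite trans_tgt -fH -!mmap_face fs.
- by rewrite trans_src -fF -!mmap_face ft.
Qed.

Lemma paste_v_thinl u P Q E0 E : P = mor_id _ -> Q = mor_id _ ->
  @paste_v (@thin_square _ _ _ _ (tr_top u) (mor_id _) (mor_id _) (tr_top u) E0)
    u P Q E = u.
Proof.
move=> eP eQ; subst P Q; case: u E0 E => A B C D F G H K tau p q r E0 E.
apply: CTrans_ob_ext => //; try exact: Mor_ext.
move=> a; move: (paste_v_composable E a); rewrite /= mmap_deg => e.
exact: ccomp_deg_l.
Qed.

Lemma paste_v_thinr u P Q E0 E : P = mor_id _ -> Q = mor_id _ ->
  @paste_v u
    (@thin_square _ _ _ _ (tr_bottom u) (mor_id _) (mor_id _) (tr_bottom u) E0)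
    P Q E = u.
Proof.
move=> eP eQ; subst P Q; case: u E0 E => A B C D F G H K tau p q r E0 E.
apply: CTrans_ob_ext => //; try exact: Mor_ext.
by move=> a; apply: ccomp_deg_r.
Qed.

Lemma paste_h_thinl u P Q E0 E : P = mor_id _ -> Q = mor_id _ ->
  @paste_h
    (@thin_square _ _ _ _ (mor_id _) (tr_left u) (tr_left u) (mor_id _) E0)
    u P Q E = u.
Proof.
move=> eP eQ; subst P Q; case: u E0 E => A B C D F G H K tau p q r E0 E.
apply: CTrans_ob_ext => //; try exact: Mor_ext.
move=> a; move: (paste_h_composable E a); rewrite /= mmap_deg => e.
exact: ccomp_deg_r.
Qed.

Lemma paste_h_thinr u P Q E0 E : P = mor_id _ -> Q = mor_id _ ->
  @paste_h u
    (@thin_square _ _ _ _ (mor_id _) (tr_right u) (tr_right u) (mor_id _) E0)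
    P Q E = u.
Proof.
move=> eP eQ; subst P Q; case: u E0 E => A B C D F G H K tau p q r E0 E.
apply: CTrans_ob_ext => //; try exact: Mor_ext.
by move=> a; apply: ccomp_deg_l.
Qed.

Lemma thin_paste_v u v P Q E : thin u -> thin v -> thin (@paste_v u v P Q E).
Proof.
move=> tu tv a /=; move: (paste_v_composable E a); rewrite tv => e.
by rewrite ccomp_deg_r tu !mmap_deg.
Qed.

Lemma thin_paste_h u v P Q E : thin u -> thin v -> thin (@paste_h u v P Q E).
Proof.
move=> tu tv a /=; move: (paste_h_composable E a); rewrite tu !mmap_deg => e.
by rewrite ccomp_deg_r tv.
Qed.

(** * The structure functors *)

(** The comparison between propositionally equal categories that makes functors
    composable in a pullback. *)
Definition mcast (A B : StrictCubicalCat) (e : A = B) : Mor A B :=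
  eq_rect A (fun Z : StrictCubicalCat => Mor A Z) (mor_id A) B e.

Lemma mcast_id (A : StrictCubicalCat) (e : A = A) : mcast e = mor_id A.
Proof. by rewrite (Prop_irrelevance e erefl). Qed.

Lemma mcast_comp (A B C : StrictCubicalCat) (e : A = B) (e' : B = C) e'' :
  mcast e' \m mcast e = mcast e''.
Proof. by move: e''; subst C; subst B => e''; rewrite !mcast_id mor_comp1l. Qed.

Lemma mcast_sq (A B A' B' : StrictCubicalCat) (f : Mor A A') (g : Mor B B')
    (e : A = B) (e' : A' = B') :
  Arrow (f : @Hom CCAT A A') = Arrow (g : @Hom CCAT B B') ->
  g \m mcast e = mcast e' \m f.
Proof.
by subst B B' => /(@Arrow_inj CCAT) ->; rewrite /= mor_comp1r mor_comp1l.
Qed.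

(** This commuting square is the comparison along which transformations with
    equal facing edges are pasted. *)
Lemma CFunct_ob_sq (F G : CFunct_ob) (e : F = G) :
  mcast (f_equal fcod e) \m ffun F = ffun G \m mcast (f_equal fdom e).
Proof. by subst G; rewrite /= mor_comp1r mor_comp1l. Qed.

Lemma mor_sq_paste (A B C A' B' C' : CubicalMagma)
    (F : Mor A B) (G : Mor B C) (F' : Mor A' B') (G' : Mor B' C')
    (a : Mor A A') (b : Mor B B') (c : Mor C C') :
  b \m F = F' \m a -> c \m G = G' \m b -> c \m (G \m F) = (G' \m F') \m a.
Proof. by move=> /esym EF /esym EG; apply: esym (mor_sq_comp EF EG). Qed.

Definition refl0 : Functor CCAT CFUNCT.
Proof.
unshelve refine (@Build_Functor CCAT CFUNCT
  (fun C => CFunctOb (mor_id C))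
  (fun C D f => @CFunctHom (CFunctOb (mor_id C)) (CFunctOb (mor_id D)) f f _)
  _ _).
- exact: Mor_ext.
- by move=> C; apply: CFunct_hom_ext.
- by move=> C D E g f; apply: CFunct_hom_ext.
Defined.

Definition refl1 : Functor CFUNCT CTRANS.
Proof.
unshelve refine (@Build_Functor CFUNCT CTRANS
  (fun F => @thin_square _ _ _ _ (ffun F) (mor_id _) (mor_id _) (ffun F) _)
  (fun F G f => @Build_CTrans_hom (thin_square _) (thin_square _)
     (hdom f) (hcod f) (hdom f) (hcod f) _ _ _ _ _)
  _ _).
- exact: Mor_ext.
- exact: hsq f.
- exact: Mor_ext.
- exact: Mor_ext.
- exact: hsq f.
- abstract (by move=> a /=; rewrite mmap_deg (mor_sqE _ (hsq f))).
- by move=> F; apply: CTrans_hom_ext.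
- by move=> F G H g f; apply: CTrans_hom_ext.
Defined.

Definition refl2 : Functor CFUNCT CTRANS.
Proof.
unshelve refine (@Build_Functor CFUNCT CTRANS
  (fun F => @thin_square _ _ _ _ (mor_id _) (ffun F) (ffun F) (mor_id _) _)
  (fun F G f => @Build_CTrans_hom (thin_square _) (thin_square _)
     (hdom f) (hdom f) (hcod f) (hcod f) _ _ _ _ _)
  _ _).
- exact: Mor_ext.
- exact: Mor_ext.
- exact: hsq f.
- exact: hsq f.
- exact: Mor_ext.
- abstract (by move=> a /=; rewrite mmap_deg (mor_sqE _ (hsq f))).
- by move=> F; apply: CTrans_hom_ext.
- by move=> F G H g f; apply: CTrans_hom_ext.
Defined.

Definition connM : Functor CFUNCT CTRANS.
Proof.
unshelve refine (@Build_Functor CFUNCT CTRANS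
  (fun F => @thin_square _ _ _ _ (ffun F) (mor_id _) (ffun F) (mor_id _) _)
  (fun F G f => @Build_CTrans_hom (thin_square _) (thin_square _)
     (hdom f) (hcod f) (hcod f) (hcod f) _ _ _ _ _)
  _ _).
- by [].
- exact: hsq f.
- exact: Mor_ext.
- exact: hsq f.
- exact: Mor_ext.
- abstract (by move=> a /=; rewrite mmap_deg (mor_sqE _ (hsq f))).
- by move=> F; apply: CTrans_hom_ext.
- by move=> F G H g f; apply: CTrans_hom_ext.
Defined.

Definition connP : Functor CFUNCT CTRANS.
Proof.
unshelve refine (@Build_Functor CFUNCT CTRANS
  (fun F => @thin_square _ _ _ _ (mor_id _) (ffun F) (mor_id _) (ffun F) _)
  (fun F G f => @Build_CTrans_hom (thin_square _) (thin_square _)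
     (hdom f) (hdom f) (hdom f) (hcod f) _ _ _ _ _)
  _ _).
- by [].
- exact: Mor_ext.
- exact: hsq f.
- exact: Mor_ext.
- exact: hsq f.
- abstract (by move=> a /=; rewrite mmap_deg (mor_sqE _ (hsq f))).
- by move=> F; apply: CTrans_hom_ext.
- by move=> F G H g f; apply: CTrans_hom_ext.
Defined.

Definition comp_ob (F G : CFunct_ob) (e : fcod F = fdom G) : CFunct_ob :=
  CFunctOb (ffun G \m mcast e \m ffun F).

Definition comp : Functor (Pullback tau10 sigma10) CFUNCT.
Proof.
unshelve refine (@Build_Functor (Pullback tau10 sigma10) CFUNCT
  (fun p => comp_ob (pb_eq p))
  (fun p q f => @CFunctHom (comp_ob _) (comp_ob _)
     (hdom (pbh1 f)) (hcod (pbh2 f)) _) _ _).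
- apply: mor_sq_paste (hsq (pbh1 f)) (mor_sq_paste _ (hsq (pbh2 f))).
  exact: mcast_sq (pbh_eq f).
- by move=> p; apply: CFunct_hom_ext.
- by move=> p q r g f; apply: CFunct_hom_ext.
Defined.

Definition comp1_ob (u v : CTrans_ob) (e : tau21_1 u = sigma21_1 v) :
  CTrans_ob := paste_v (CFunct_ob_sq e).

Definition comp2_ob (u v : CTrans_ob) (e : tau21_2 u = sigma21_2 v) :
  CTrans_ob := paste_h (CFunct_ob_sq e).

Lemma mcast_hdom (F G F' G' : CFunct_ob) (f : CFunct_hom F F')
    (g : CFunct_hom G G') (e : F = G) (e' : F' = G') :
  Arrow (f : @Hom CFUNCT F F') = Arrow (g : @Hom CFUNCT G G') ->
  hdom g \m mcast (f_equal fdom e) = mcast (f_equal fdom e') \m hdom f.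
Proof.
move=> /(f_equal (fun a => Arrow (fmap sigma10 (ahom a)))) /= E.
exact: mcast_sq.
Qed.

Lemma mcast_hcod (F G F' G' : CFunct_ob) (f : CFunct_hom F F')
    (g : CFunct_hom G G') (e : F = G) (e' : F' = G') :
  Arrow (f : @Hom CFUNCT F F') = Arrow (g : @Hom CFUNCT G G') ->
  hcod g \m mcast (f_equal fcod e) = mcast (f_equal fcod e') \m hcod f.
Proof.
move=> /(f_equal (fun a => Arrow (fmap tau10 (ahom a)))) /= E.
exact: mcast_sq.
Qed.

Definition comp1 : Functor (Pullback tau21_1 sigma21_1) CTRANS.
Proof.
unshelve refine (@Build_Functor (Pullback tau21_1 sigma21_1) CTRANS
  (fun p => comp1_ob (pb_eq p))
  (fun p q f => @Build_CTrans_hom (comp1_ob _) (comp1_ob _)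
     (c00 (pbh1 f)) (c10 (pbh1 f)) (c01 (pbh2 f)) (c11 (pbh2 f))
     _ _ _ _ _) _ _).
- exact: c_top (pbh1 f).
- apply: mor_sq_paste (c_right (pbh1 f)) (mor_sq_paste _ (c_right (pbh2 f))).
  exact: mcast_hcod (pbh_eq f).
- apply: mor_sq_paste (c_left (pbh1 f)) (mor_sq_paste _ (c_left (pbh2 f))).
  exact: mcast_hdom (pbh_eq f).
- exact: c_bottom (pbh2 f).
- move=> a /=; apply: mmap_ccomp_congr.
  + rewrite (mor_sqE _ (c_right (pbh2 f))).
    by rewrite (mor_sqE _ (mcast_hcod _ (pb_eq q) (pbh_eq f))) /= c_trans.
  + rewrite c_trans (mor_sqE _ (mcast_hdom _ (pb_eq q) (pbh_eq f))) /=.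
    by rewrite (mor_sqE _ (c_left (pbh1 f))).
- by move=> p; apply: CTrans_hom_ext.
- by move=> p q r g f; apply: CTrans_hom_ext.
Defined.

Definition comp2 : Functor (Pullback tau21_2 sigma21_2) CTRANS.
Proof.
unshelve refine (@Build_Functor (Pullback tau21_2 sigma21_2) CTRANS
  (fun p => comp2_ob (pb_eq p))
  (fun p q f => @Build_CTrans_hom (comp2_ob _) (comp2_ob _)
     (c00 (pbh1 f)) (c10 (pbh2 f)) (c01 (pbh1 f)) (c11 (pbh2 f))
     _ _ _ _ _) _ _).
- apply: mor_sq_paste (c_top (pbh1 f)) (mor_sq_paste _ (c_top (pbh2 f))).
  exact: mcast_hdom (pbh_eq f).
- exact: c_right (pbh2 f).
- exact: c_left (pbh1 f).
- apply: mor_sq_paste (c_bottom (pbh1 f)) (mor_sq_paste _ (c_bottom (pbh2 f))).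
  exact: mcast_hcod (pbh_eq f).
- move=> a /=; apply: mmap_ccomp_congr.
  + rewrite c_trans (mor_sqE _ (mcast_hdom _ (pb_eq q) (pbh_eq f))) /=.
    by rewrite (mor_sqE _ (c_top (pbh1 f))).
  + rewrite (mor_sqE _ (c_bottom (pbh2 f))).
    by rewrite (mor_sqE _ (mcast_hcod _ (pb_eq q) (pbh_eq f))) /= c_trans.
- by move=> p; apply: CTrans_hom_ext.
- by move=> p q r g f; apply: CTrans_hom_ext.
Defined.

(** * Laws on objects *)

Lemma CFunctOb_ffun (F : CFunct_ob) : CFunctOb (ffun F) = F.
Proof. by case: F. Qed.

Section CastComposite.
Variables (A B C D : StrictCubicalCat) (F : Mor A B) (G : Mor C D).

Lemma CFunctOb_mcast_irr (e e' : B = C) :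
  CFunctOb (G \m mcast e \m F) = CFunctOb (G \m mcast e' \m F).
Proof. by rewrite (Prop_irrelevance e e'). Qed.

Lemma CFunctOb_mcast1l (e : B = B) :
  CFunctOb (mor_id B \m mcast e \m F) = CFunctOb F.
Proof. by rewrite mcast_id !mor_comp1l. Qed.

Lemma CFunctOb_mcast1r (e : C = C) :
  CFunctOb (G \m mcast e \m mor_id C) = CFunctOb G.
Proof. by rewrite mcast_id !mor_comp1r. Qed.

End CastComposite.

Lemma comp_obA F G H e1 e2 e3 e4 :
  @comp_ob (@comp_ob F G e1) H e2 = @comp_ob F (@comp_ob G H e3) e4.
Proof.
rewrite (Prop_irrelevance (e1 : fcod F = fdom G) e4).
rewrite (Prop_irrelevance (e2 : fcod G = fdom H) e3).
by congr CFunctOb; apply: Mor_ext.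
Qed.

Lemma comp_ob1l F e : @comp_ob (refl0 (fdom F)) F e = F.
Proof. exact: etrans (CFunctOb_mcast1r _ _) (CFunctOb_ffun F). Qed.

Lemma comp_ob1r F e : @comp_ob F (refl0 (fcod F)) e = F.
Proof. exact: etrans (CFunctOb_mcast1l _ _) (CFunctOb_ffun F). Qed.

Lemma comp1_obA u v w e1 e2 e3 e4 :
  @comp1_ob (@comp1_ob u v e1) w e2 = @comp1_ob u (@comp1_ob v w e3) e4.
Proof.
rewrite (Prop_irrelevance (e1 : tau21_1 u = sigma21_1 v) e4).
rewrite (Prop_irrelevance (e2 : tau21_1 v = sigma21_1 w) e3).
exact: paste_vA.
Qed.

Lemma comp2_obA u v w e1 e2 e3 e4 :
  @comp2_ob (@comp2_ob u v e1) w e2 = @comp2_ob u (@comp2_ob v w e3) e4.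
Proof.
rewrite (Prop_irrelevance (e1 : tau21_2 u = sigma21_2 v) e4).
rewrite (Prop_irrelevance (e2 : tau21_2 v = sigma21_2 w) e3).
exact: paste_hA.
Qed.

Lemma comp_ob_interchange a b c d e1 e2 e3 e4 e5 e6 :
  @comp2_ob (@comp1_ob a b e1) (@comp1_ob c d e2) e3 =
  @comp1_ob (@comp2_ob a c e4) (@comp2_ob b d e5) e6.
Proof.
rewrite /comp2_ob /comp1_ob.
move: (CFunct_ob_sq e3) (CFunct_ob_sq e6).
rewrite (Prop_irrelevance (f_equal fdom e3) (f_equal fdom e4)).
rewrite (Prop_irrelevance (f_equal fcod e3) (f_equal fcod e5)).
rewrite (Prop_irrelevance (f_equal fdom e6) (f_equal fdom e1)).
rewrite (Prop_irrelevance (f_equal fcod e6) (f_equal fcod e2)).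
move=> E3 E6; apply: paste_interchange.
(* Both comparisons C11 a -> C00 d are transports along the same equality. *)
by rewrite !(mcast_comp _ _ (etrans (f_equal fcod e1) (f_equal fdom e5))).
Qed.

Lemma CFunctOb_inj (A B : StrictCubicalCat) (F G : Mor A B) :
  CFunctOb F = CFunctOb G -> F = G.
Proof.
by move=> e; have := CFunct_ob_sq e; rewrite !mcast_id mor_comp1r mor_comp1l.
Qed.

(** Both sides of each law relating reflexions, connections and compositions
    are thin, so such a law reduces to the equality of four faces. *)
Lemma thin_ext (u v : CTrans_ob) : thin u -> thin v ->
  sigma21_1 u = sigma21_1 v -> tau21_1 u = tau21_1 v ->
  sigma21_2 u = sigma21_2 v -> tau21_2 u = tau21_2 v -> u = v.
Proof.
move=> tu tv e1 e2 e3 e4.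
have eA := f_equal fdom e1; have eB := f_equal fcod e1.
have eC := f_equal fdom e2; have eD := f_equal fcod e2.
case: u v tu tv e1 e2 e3 e4 eA eB eC eD => A B C D F G H K tau p q r.
case=> A' B' C' D' F' G' H' K' tau' p' q' r' tu tv /= e1 e2 e3 e4 eA eB eC eD.
subst A' B' C' D'; have {}e1 := CFunctOb_inj e1; have {}e2 := CFunctOb_inj e2.
have {}e3 := CFunctOb_inj e3; have {}e4 := CFunctOb_inj e4.
by apply: CTrans_ob_ext => // a; rewrite [LHS]tu [RHS]tv /= e1 e4.
Qed.

Lemma thin_comp1 u v e : thin u -> thin v -> thin (@comp1_ob u v e).
Proof. exact: thin_paste_v. Qed.

Lemma thin_comp2 u v e : thin u -> thin v -> thin (@comp2_ob u v e).
Proof. exact: thin_paste_h. Qed.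

Ltac thin_law :=
  apply: thin_ext;
  first [ apply: CFunctOb_mcast_irr | apply: CFunctOb_mcast1l
        | apply: CFunctOb_mcast1r | apply: esym; apply: CFunctOb_mcast1l
        | by repeat first [ apply: thin_comp1 | apply: thin_comp2
                          | apply: thin_thin_square ]
        | by [] ].

Lemma refl1_comp F G e e' :
  refl1 (@comp_ob F G e) = @comp2_ob (refl1 F) (refl1 G) e'.
Proof. thin_law. Qed.

Lemma refl2_comp F G e e' :
  refl2 (@comp_ob F G e) = @comp1_ob (refl2 F) (refl2 G) e'.
Proof. thin_law. Qed.

Lemma connP_comp F G e e1 e2 e3 :
  connP (@comp_ob F G e) =
  @comp2_ob (@comp1_ob (connP F) (refl1 F) e1)
            (@comp1_ob (refl2 F) (connP G) e2) e3.
Proof. thin_law. Qed.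

Lemma connM_comp F G e e1 e2 e3 :
  connM (@comp_ob F G e) =
  @comp2_ob (@comp1_ob (connM F) (refl2 G) e1)
            (@comp1_ob (refl1 G) (connM G) e2) e3.
Proof. thin_law. Qed.

Lemma comp1_connPM F e : @comp1_ob (connP F) (connM F) e = refl2 F.
Proof. thin_law. Qed.

Lemma comp2_connPM F e : @comp2_ob (connP F) (connM F) e = refl1 F.
Proof. thin_law. Qed.

(** * The strict cubical 2-category *)

(** Evaluation by simpl comes before reflexivity: the conversion test would
    otherwise compare the functors themselves, with all their proofs. *)
Ltac on_objects :=
  lazymatch goal with
  | |- @eq (Functor _ CCAT) _ _ => apply: Functor_ext
  | |- @eq (Functor _ CFUNCT) _ _ =>
      apply: CFUNCT_functor_ext; [|apply: Functor_ext ..]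
  | |- @eq (Functor _ CTRANS) _ _ =>
      apply: CTRANS_functor_ext; [|apply: Functor_ext ..]
  end;
  try (by intros; simpl; reflexivity); move=> z.

Theorem proposition5 :
  exists (refl0 : Functor CCAT CFUNCT)
         (refl1 refl2 connM connP : Functor CFUNCT CTRANS)
         (comp : Functor (Pullback tau10 sigma10) CFUNCT)
         (comp1 : Functor (Pullback tau21_1 sigma21_1) CTRANS)
         (comp2 : Functor (Pullback tau21_2 sigma21_2) CTRANS),
    is_strict_cubical_2cat
      sigma10 tau10 sigma21_1 sigma21_2 tau21_1 tau21_2
      refl0 refl1 refl2 connM connP comp comp1 comp2.
Proof.
exists refl0, refl1, refl2, connM, connP, comp, comp1, comp2.
constructor; intros; on_objects.
(* The faces of reflexions and connections, then those of composites. *)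
all: try exact: CFunctOb_ffun; try exact: CFunctOb_mcast_irr.
(* Both connections on an identity functor are reflexions. *)
- by apply: CTrans_ob_ext.
- by apply: CTrans_ob_ext.
- exact: comp_obA.
- exact: comp1_obA.
- exact: comp2_obA.
- exact: comp_ob1l.
- exact: comp_ob1r.
- by apply: paste_v_thinl; apply: mcast_id.
- by apply: paste_v_thinr; apply: mcast_id.
- by apply: paste_h_thinl; apply: mcast_id.
- by apply: paste_h_thinr; apply: mcast_id.
- exact: comp_ob_interchange.
- exact: refl1_comp.
- exact: refl2_comp.
- exact: connP_comp.
- exact: connM_comp.
- exact: comp1_connPM.
- exact: comp2_connPM.
Qed.
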